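(* Let $\mathbf k$ be a field of characteristic zero. Every finite-dimensional solvable Lie algebra over $\mathbf k$ can be completely disassembled.
   Context: Two Lie algebra structures (Lie brackets) $[\cdot,\cdot]_1,[\cdot,\cdot]_2$ on the same vector space $V$ are compatible if $[\cdot,\cdot]_1+[\cdot,\cdot]_2$ is again a Lie bracket on $V$; their sum is the Lie algebra structure with this bracket. An $n$-dyon ($n\ge 2$) is a Lie algebra structure on an $n$-dimensional vector space isomorphic to the direct sum of the non-abelian $2$-dimensional Lie algebra $\langle e_1,e_2\mid [e_1,e_2]=e_2\rangle$ and the $(n-2)$-dimensional abelian Lie algebra. An $n$-triadon ($n\ge 3$) is a Lie algebra structure isomorphic to the direct sum of the $3$-dimensional Heisenberg algebra $\langle \varepsilon_1,\varepsilon_2,\varepsilon_3\mid [\varepsilon_1,\varepsilon_2]=\varepsilon_3,\ [\varepsilon_1,\varepsilon_3]=[\varepsilon_2,\varepsilon_3]=0\rangle$ and the $(n-3)$-dimensional abelian Lie algebra. Dyons and triadons are called lieons. A disassembling of a Lie algebra structure $\mathfrak g$ on $V$ is a finite rooted tree in which every non-leaf vertex has at least two children, together with an assignment $v\mapsto\mathfrak g_v$ of a Lie algebra structure on $V$ to every vertex, such that the root is assigned $\mathfrak g$ and, for every non-leaf vertex $v$ with children $v_1,\dots,v_p$, the structures $\mathfrak g_{v_1},\dots,\mathfrak g_{v_p}$ are mutually (pairwise) compatible and $\mathfrak g_v=\mathfrak g_{v_1}+\dots+\mathfrak g_{v_p}$. The disassembling is complete if all leaves are assigned lieons. The abelian (zero)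 structure is regarded as the empty sum of lieons (a convention that matters only in dimension at most $1$). *)

(* Defs.v *)
From HB Require Import structures.
From mathcomp Require Import all_boot all_order all_algebra.

Set Implicit Arguments.
Unset Strict Implicit.
Unset Printing Implicit Defensive.

Import GRing.Theory.
Local Open Scope ring_scope.

Section LieStructures.
Variable k : fieldType.

Section Brackets.
Variable V : lmodType k.
Implicit Types g h : V -> V -> V.

Record is_lie_bracket g : Prop := IsLieBracket {
  lie_bilinear : bilinear_for *:%R *:%R g;
  lie_alternating : forall x, g x x = 0;
  lie_jacobi : forall x y z, g x (g y z) + g y (g z x) + g z (g x y) = 0 }.

Definition compatible g h : Prop :=
  is_lie_bracket (fun x y => g x y + h x y).

Definition abelian_bracket : V -> V -> V := fun _ _ => 0.

End Brackets.

Definition direct_sum_bracket (U W : lmodType k)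
    (g : U -> U -> U) (h : W -> W -> W) : U * W -> U * W -> U * W :=
  fun x y => (g x.1 y.1, h x.2 y.2).

Definition lie_isomorphic (U W : lmodType k)
    (g : U -> U -> U) (h : W -> W -> W) : Prop :=
  exists f : {linear U -> W},
    bijective f /\ forall x y, f (g x y) = h (f x) (f y).

(* In the standard bases, e_1 being indexed by 0: the alternating bilinear maps
   whose only nonzero bracket of basis vectors is [e_1, e_2], equal to e_2,
   respectively e_3. *)
Definition nonabelian2_bracket (u v : 'rV[k]_2) : 'rV[k]_2 :=
  (u 0 0 * v 0 1 - u 0 1 * v 0 0) *: delta_mx 0 1.

Definition heisenberg_bracket (u v : 'rV[k]_3) : 'rV[k]_3 :=
  (u 0 0 * v 0 1 - u 0 1 * v 0 0) *: delta_mx 0 ord_max.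

Section FiniteDimension.
Variable V : vectType k.
Implicit Types g : V -> V -> V.

(* For bilinear g, brackets of basis vectors of U span the same subspace as all
   brackets of vectors of U; see lie_derivedP. *)
Definition lie_derived g (U : {vspace V}) : {vspace V} :=
  <<[seq g x y | x <- vbasis U, y <- vbasis U]>>%VS.

Lemma lie_derivedP g (U W : {vspace V}) : bilinear_for *:%R *:%R g ->
  (lie_derived g U <= W)%VS <->
  (forall x y, x \in U -> y \in U -> g x y \in W).
Proof.
case=> gl gr; split=> [/span_subvP sUW x y Ux Uy | sUW]; last first.
  apply/span_subvP=> _ /allpairsP[[x y] /= [xU yU ->]].
  by apply: sUW; apply: vbasis_mem.
pose gl' z : {linear V -> V} :=
  HB.pack ((fun u => g u z) : V -> V) (GRing.isLinear.Build _ _ _ _ _ (gl z)).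
pose gr' z : {linear V -> V} :=
  HB.pack (g z : V -> V) (GRing.isLinear.Build _ _ _ _ _ (gr z)).
rewrite (coord_vbasis Ux) -[g _ y]/(gl' y _) linear_sum rpred_sum // => i _.
rewrite linearZ rpredZ //= (coord_vbasis Uy) -[g _ _]/(gr' _ _) linear_sum.
rewrite rpred_sum // => j _; rewrite linearZ rpredZ //=.
by apply: sUW; apply: allpairs_f; rewrite mem_nth ?size_tuple.
Qed.

Definition lie_solvable g : Prop :=
  exists n : nat, iter n (lie_derived g) fullv = 0%VS.

Definition is_dyon g : Prop :=
  (2 <= \dim {:V})%N /\
  lie_isomorphic g (direct_sum_bracket nonabelian2_bracket
                      (@abelian_bracket 'rV[k]_(\dim {:V} - 2))).

Definition is_triadon g : Prop :=
  (3 <= \dim {:V})%N /\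
  lie_isomorphic g (direct_sum_bracket heisenberg_bracket
                      (@abelian_bracket 'rV[k]_(\dim {:V} - 3))).

Definition is_lieon g : Prop := is_dyon g \/ is_triadon g.

End FiniteDimension.

End LieStructures.

Inductive rose_tree (T : Type) : Type :=
  Vertex of T & seq (rose_tree T).

Definition root_label (T : Type) (t : rose_tree T) : T :=
  let: Vertex a _ := t in a.

Section Disassembling.
Variables (k : fieldType) (V : vectType k).
Local Notation bracket := (V -> V -> V).

(* In the predicates on trees, the foldr is the conjunction over the children
   of the recursive calls. *)

Definition splits_as (g : bracket) (gs : seq bracket) : Prop :=
  [/\ (2 <= size gs)%N,
      forall i j, (i < j < size gs)%N ->
        compatible (nth (@abelian_bracket k V) gs i)
                   (nth (@abelian_bracket k V) gs j) &
      forall x y, g x y = \sum_(h <- gs) h x y].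

Fixpoint is_disassembling (t : rose_tree bracket) : Prop :=
  let: Vertex g ts := t in
  [/\ is_lie_bracket g,
      ts = [::] \/ splits_as g (map (@root_label bracket) ts) &
      foldr (fun s P => is_disassembling s /\ P) True ts].

Fixpoint leaves_are_lieons (t : rose_tree bracket) : Prop :=
  let: Vertex g ts := t in
  (ts = [::] -> is_lieon g) /\
  foldr (fun s P => leaves_are_lieons s /\ P) True ts.

(* The first disjunct is the convention that the zero bracket is the empty sum
   of lieons; it is needed only in dimension at most 1, where there are no
   lieons. *)
Definition completely_disassemblable (g : bracket) : Prop :=
  (forall x y, g x y = 0) \/
  exists t : rose_tree bracket,
    [/\ forall x y, root_label t x y = g x y,
        is_disassembling t & leaves_are_lieons t].

End Disassembling.

(* Main.v *)
Require Import Defs.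
From HB Require Import structures.
From mathcomp Require Import all_boot all_order all_algebra.
From mathcomp Require Import ring.
Set Implicit Arguments.
Unset Strict Implicit.
Unset Printing Implicit Defensive.
Import GRing.Theory.
Local Open Scope ring_scope.

(** Let U be a solvable subalgebra, W a hyperplane of U containing [U, U] and e
    a vector of U outside W. Then W is an ideal of U, and the bracket of U is
    the sum of two brackets: that of W, with e made central, and the one that
    keeps only the action of e, U = <e> + W with W made abelian. Both are Lie
    brackets, and the first is disassembled by induction on the dimension.

    The second bracket is determined by a linear form psi, with kernel W, and
    the endomorphism A by which e acts: [x, y] = psi x A y - psi y A x. Such
    brackets satisfy the Jacobi identity as soon as psi vanishes on the image of
    A, and they depend additively on A. Writing A as a sum of endomorphisms
    x |-> alpha x b of rank one, with psi b = 0, therefore disassembles the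
    second bracket into brackets of the form (psi /\ alpha) b, and each of these
    is a lieon: a dyon if alpha b is nonzero ([dyon_decomposable]), a triadon if
    alpha b is zero ([triadon_decomposable]).

    To keep all brackets on the same space V, the bracket of a subalgebra U is
    replaced by (x, y) |-> [p x, p y], where p is a linear projection of V onto
    U; its kernel is then central. Compatibility comes for free, since all
    trees are built from binary splittings of known Lie brackets
    ([add_disassemblable]). *)

(** * Gluing disassemblings *)

Section Disassemblability.
Variables (k : fieldType) (V : vectType k).
Implicit Types g h : V -> V -> V.

Lemma eq_lie_bracket g h :
  (forall x y, g x y = h x y) -> is_lie_bracket g -> is_lie_bracket h.
Proof.
move=> gh [[gl gr] g0 gJ]; split=> [|x|x y z]; last by rewrite -!gh.
  by split=> z a u v; rewrite -!gh ?gl ?gr.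
by rewrite -gh.
Qed.

Lemma eq_disassemblable g h : (forall x y, g x y = h x y) ->
  completely_disassemblable g -> completely_disassemblable h.
Proof.
move=> gh [g0 | [t [tg dis_t leaves_t]]]; [left | right] => [x y|].
  by rewrite -gh.
by exists t; split=> // x y; rewrite tg.
Qed.

Lemma lieon_disassemblable g :
  is_lie_bracket g -> is_lieon g -> completely_disassemblable g.
Proof.
move=> g_lie g_lieon; right; exists (Vertex g [::]).
by split=> //=; split=> //; left.
Qed.

(** The zero bracket counts as disassemblable without having a tree, so a zero
    summand must be dropped instead of becoming a child of the new root. *)
Lemma add_disassemblable g h :
    is_lie_bracket (fun x y => g x y + h x y) ->
    completely_disassemblable g -> completely_disassemblable h ->
  completely_disassemblable (fun x y => g x y + h x y).
Proof.
move=> gh_lie [g0 | dis_g].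
  by apply: eq_disassemblable => x y; rewrite g0 add0r.
case=> [h0 | [u [uh dis_u leaves_u]]].
  by apply: (@eq_disassemblable g) (or_intror dis_g) => x y; rewrite h0 addr0.
case: dis_g => t [tg dis_t leaves_t].
right; exists (Vertex (fun x y => g x y + h x y) [:: t; u]); split=> //=.
split=> //; right; split=> // [[|i] [|[|j]] /andP[] // _ _ | x y].
  by apply: eq_lie_bracket gh_lie => x y; rewrite /= tg uh.
by rewrite /= !big_cons big_nil tg uh addr0.
Qed.

End Disassemblability.

(** * Linear forms and coordinates *)

Section LinearAlgebra.
Variables (k : fieldType) (V : vectType k).

Lemma separating_form (D : {vspace V}) e : e \notin D ->
  exists phi : {scalar V}, (forall x, x \in D -> phi x = 0) /\ phi e = 1.
Proof.
move=> eD; pose e' := e - projv D e.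
have e'0 : e' != 0.
  by rewrite subr_eq0; apply: contraNneq eD => ->; apply: memv_proj.
have [i ci] : exists i, coord (vbasis {:V}) i e' != 0.
  apply/existsP; apply: contraNT e'0; rewrite negb_exists => /forallP c0.
  rewrite (coord_vbasis (memvf e')) big1 // => i _.
  by move: (c0 i); rewrite negbK => /eqP ->; rewrite scale0r.
pose c := coord (vbasis {:V}) i e'.
pose f x := c^-1 * coord (vbasis {:V}) i (x - projv D x).
have f_lin : scalar f.
  move=> a x y; rewrite /f !linearB !linearP /=; ring.
pose phi : {scalar V} := HB.pack f (GRing.isLinear.Build _ _ _ _ f f_lin).
exists phi; split=> [x xD|] /=.
  by rewrite /f projv_id // subrr linear0 mulr0.
by rewrite /f mulVf.
Qed.

Lemma scalar_nonzero_or_zero (phi : {scalar V}) :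
  (forall x, phi x = 0) \/ exists x, phi x != 0.
Proof.
have [/existsP[i xi] | ] :=
  boolP [exists i : 'I_(\dim {:V}), phi (vbasis {:V})`_i != 0].
  by right; exists (vbasis {:V})`_i.
rewrite negb_exists => /forallP phi0; left=> x.
rewrite (coord_vbasis (memvf x)) linear_sum big1 // => i _.
by move: (phi0 i); rewrite negbK linearZ /= => /eqP ->; rewrite mulr0.
Qed.

(** The s_j span a complement of the common kernel K of the forms phi_i, so the
    forms together with coordinates on K along the s_j identify V with
    k^m x k^(n-m). This is how a lieon is recognized: its bracket depends on a
    few linear forms only, and takes its values on the line of some s_j. *)
Lemma complete_dual_family m (phi : 'I_m -> V -> k) (s : 'I_m -> V) :
    (forall i, scalar (phi i)) -> (forall i j, phi i (s j) = (i == j)%:R) ->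
  (m <= \dim {:V})%N /\
  exists f : {linear V -> ('rV[k]_m * 'rV[k]_(\dim {:V} - m))%type},
    [/\ bijective f, forall x, (f x).1 = \row_i phi i x &
        forall j, (f (s j)).2 = 0].
Proof.
move=> phi_lin phi_s; pose F0 x := \row_i phi i x.
have F0_lin : linear F0.
  by move=> a x y; apply/rowP=> i; rewrite !mxE phi_lin.
pose F : {linear V -> 'rV[k]_m} :=
  HB.pack F0 (GRing.isLinear.Build _ _ _ _ F0 F0_lin).
have FE x i : F x 0 i = phi i x by rewrite mxE.
pose S (u : 'rV[k]_m) := \sum_i u 0 i *: s i.
have SK : cancel S F.
  move=> u; rewrite linear_sum; apply/rowP=> i; rewrite summxE (bigD1 i) //.
  rewrite big1 => [|j ji]; rewrite linearZ mxE FE phi_s.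
    by rewrite eqxx mulr1 /= addr0.
  by rewrite eq_sym (negPf ji) mulr0.
have S_lin : linear S.
  move=> a u v; rewrite scaler_sumr -big_split; apply: eq_bigr => i _ /=.
  by rewrite !mxE scalerDl scalerA.
have sS j : s j = S (F (s j)).
  rewrite /S (bigD1 j) //= big1 => [|i ij]; rewrite mxE phi_s.
    by rewrite eqxx scale1r addr0.
  by rewrite (negPf ij) scale0r.
pose K := lker (linfun F).
have dimK : (\dim K + m = \dim {:V})%N.
  rewrite -(limg_ker_dim (linfun F) fullv) capfv; congr (_ + _)%N.
  suff -> : limg (linfun F) = fullv by rewrite dimvf /dim /= mul1n.
  apply/vspaceP=> u; rewrite memvf -(SK u) -(lfunE F).
  by rewrite memv_img ?memvf.
split; first by rewrite -dimK leq_addl.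
have -> : (\dim {:V} - m)%N = \dim K by rewrite -dimK addnK.
pose h x := \row_i coord (vbasis K) i (x - S (F x)).
pose f x := (F x, h x).
have f_lin : linear f.
  move=> a x y; rewrite /f linearP; congr (_, _); apply/rowP=> i.
  rewrite !mxE linearP /= S_lin opprD addrACA -scalerN -scalerDr.
  by rewrite linearP.
pose fL : {linear V -> ('rV[k]_m * 'rV[k]_(\dim K))%type} :=
  HB.pack f (GRing.isLinear.Build _ _ _ _ f f_lin).
exists fL; split=> // [|j] /=; last first.
  by apply/rowP=> i; rewrite !mxE -sS subrr linear0.
pose back (uw : 'rV[k]_m * 'rV[k]_(\dim K)) :=
  S uw.1 + \sum_(i < \dim K) uw.2 0 i *: (vbasis K)`_i.
exists back => [x | [u w]]; rewrite /back /=.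
  have xK : x - S (F x) \in K by rewrite memv_ker lfunE linearB SK subrr.
  rewrite -[RHS](subrKC (S (F x))); congr (_ + _).
  by rewrite [RHS](coord_vbasis xK); apply: eq_bigr => i _; rewrite mxE.
set z := \sum_i _.
have /eqP Fz : F z == 0.
  rewrite -(lfunE F) -memv_ker rpred_sum // => i _.
  by rewrite rpredZ // vbasis_mem // mem_nth ?size_tuple.
have Fuz : F (S u + z) = u by rewrite linearD SK Fz addr0.
rewrite /f Fuz; congr (_, _); apply/rowP=> i; rewrite mxE Fuz addrC addKr.
by rewrite coord_sum_free // (basis_free (vbasisP K)).
Qed.

End LinearAlgebra.

(** * Brackets defined by a linear form and an endomorphism *)

Section HyperplaneBrackets.
Variables (k : fieldType) (V : vectType k).

(** When psi vanishes on the image of A and psi e = 1, A e = 0, this is the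
    semidirect product of the line of e, acting by A, with the abelian algebra
    ker psi. *)
Definition hyperplane_bracket (psi : V -> k) (A : V -> V) : V -> V -> V :=
  fun x y => psi x *: A y - psi y *: A x.

(** All brackets lie in ker psi, so [x, [y, z]] = psi x A [y, z], and the cyclic
    sum of psi x psi y A^2 z - psi x psi z A^2 y cancels in pairs. *)
Lemma hyperplane_lie (psi : {scalar V}) (A : {linear V -> V}) :
  (forall x, psi (A x) = 0) -> is_lie_bracket (hyperplane_bracket psi A).
Proof.
move=> psiA; rewrite /hyperplane_bracket; split=> [|x|x y z].
- split=> z a u v; rewrite !linearP /= scalerDl -scalerA.
    by rewrite addrACA -scalerDr.
  by rewrite opprD addrACA -scalerBr.
- exact: subrr.
have psi0 u v : psi (psi u *: A v - psi v *: A u) = 0.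
  by rewrite linearB !linearZ /= !psiA !mulr0 subrr.
have AE u v : A (psi u *: A v - psi v *: A u) =
    psi u *: A (A v) - psi v *: A (A u) by rewrite linearB !linearZ.
rewrite !psi0 !scale0r !subr0 !AE !scalerBr !scalerA.
rewrite [psi y * psi x]mulrC [psi z * psi x]mulrC [psi z * psi y]mulrC.
by rewrite [X in X + _]addrC !subrKA subrr.
Qed.

(** With c = alpha b, the vectors e / c and b are dual to the forms c psi and
    alpha / c, whose wedge product is psi /\ alpha, and [e / c, b] = b. *)
Lemma dyon_decomposable (psi alpha : {scalar V}) (e b : V) :
    psi e = 1 -> alpha e = 0 -> psi b = 0 -> alpha b != 0 ->
  is_dyon (fun x y => (psi x * alpha y - psi y * alpha x) *: b).
Proof.
move=> psi_e alpha_e psi_b; set c := alpha b => c0.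
pose phi (i : 'I_2) x := [:: c * psi x; c^-1 * alpha x]`_i.
pose s (i : 'I_2) := [:: c^-1 *: e; b]`_i.
have phi_lin i : scalar (phi i).
  by case: i => [[|[|]]] // ? a x y; rewrite /phi /= linearP /=; ring.
have phi_s i j : phi i (s j) = (i == j)%:R.
  case: i => [[|[|]]] //= ?; case: j => [[|[|]]] //= ?; rewrite /phi /s /=.
  - by rewrite linearZ /= psi_e mulr1 divff.
  - by rewrite psi_b mulr0.
  - by rewrite linearZ /= alpha_e !mulr0.
  - by rewrite mulVf.
have [leVm [f [f_bij f1 f2]]] := complete_dual_family phi_lin phi_s.
split=> //; exists f; split=> // x y; rewrite linearZ /=.
rewrite [f b]surjective_pairing f1 (f2 1); congr (_, _); last exact: scaler0.
rewrite /nonabelian2_bracket !f1; apply/rowP=> i; rewrite !mxE /phi /=.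
by case: i => [[|[|]]] //= ?; rewrite ?psi_b ?mulVf //; field.
Qed.

(** Here b is central, and e, d, b play the roles of the Heisenberg generators,
    since [e, d] = b. *)
Lemma triadon_decomposable (psi alpha : {scalar V}) (e d b : V) :
    psi e = 1 -> alpha e = 0 -> psi d = 0 -> alpha d = 1 ->
    psi b = 0 -> alpha b = 0 -> b != 0 ->
  is_triadon (fun x y => (psi x * alpha y - psi y * alpha x) *: b).
Proof.
move=> psi_e alpha_e psi_d alpha_d psi_b alpha_b b0.
have [chi [_ chi_b]] : exists chi : {scalar V},
    (forall x, x \in 0%VS -> chi x = 0) /\ chi b = 1.
  by apply: separating_form; rewrite memv0.
(* Correcting chi so that it vanishes on e and d makes it dual to b. *)
pose chi' x := chi x - psi x * chi e - alpha x * chi d.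
pose phi (i : 'I_3) x := [:: psi x; alpha x; chi' x]`_i.
pose s (i : 'I_3) := [:: e; d; b]`_i.
have phi_lin i : scalar (phi i).
  by case: i => [[|[|[|]]]] // ? a x y; rewrite /phi /= ?/chi' !linearP /=; ring.
have phi_s i j : phi i (s j) = (i == j)%:R.
  case: i => [[|[|[|]]]] //= ?; case: j => [[|[|[|]]]] //= ?;
    rewrite /phi /s /= ?/chi' //=.
  - by rewrite psi_e alpha_e; ring.
  - by rewrite psi_d alpha_d; ring.
  - by rewrite psi_b alpha_b chi_b; ring.
have [leVm [f [f_bij f1 f2]]] := complete_dual_family phi_lin phi_s.
split=> //; exists f; split=> // x y; rewrite linearZ /=.
rewrite [f b]surjective_pairing f1 (f2 ord_max); congr (_, _).
  rewrite /heisenberg_bracket !f1; apply/rowP=> i; rewrite !mxE /phi /=.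
  case: i => [[|[|[|]]]] //= ?; rewrite ?psi_b ?alpha_b ?mulr0 //=.
  by rewrite /chi' chi_b psi_b alpha_b; ring.
exact: scaler0.
Qed.

(** The condition alpha e = 0 ensures that alpha is zero or independent of psi,
    so that a nonzero psi /\ alpha comes with a dual pair of vectors. *)
Lemma decomposable_disassemblable (psi alpha : {scalar V}) (e b : V) :
    psi e = 1 -> alpha e = 0 -> psi b = 0 ->
  completely_disassemblable
    (fun x y => (psi x * alpha y - psi y * alpha x) *: b).
Proof.
move=> psi_e alpha_e psi_b.
have [-> | b0] := eqVneq b 0; first by left=> x y; rewrite scaler0.
have [alpha0 | [d alpha_d]] := scalar_nonzero_or_zero alpha.
  by left=> x y; rewrite !alpha0 !mulr0 subrr scale0r.
apply: lieon_disassemblable.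
  pose A x := alpha x *: b.
  have A_lin : linear A by move=> a x y; rewrite /A linearP scalerDl scalerA.
  pose AL : {linear V -> V} :=
    HB.pack A (GRing.isLinear.Build _ _ _ _ A A_lin).
  apply: (@eq_lie_bracket _ _ (hyperplane_bracket psi AL)) => [x y|].
    by rewrite /hyperplane_bracket /= /A !scalerA -scalerBl.
  by apply: hyperplane_lie => x; rewrite /= /A linearZ /= psi_b mulr0.
have [alpha_b | alpha_b] := eqVneq (alpha b) 0; last first.
  by left; apply: dyon_decomposable psi_e alpha_e psi_b alpha_b.
right.
(* Moving d along e puts it in ker psi without changing alpha d. *)
apply: (@triadon_decomposable _ _ e ((alpha d)^-1 *: (d - psi d *: e)));
  rewrite // linearZ linearB linearZ /=.
  by rewrite psi_e mulr1 subrr mulr0.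
by rewrite alpha_e mulr0 subr0 mulVf.
Qed.

(** The bracket is additive in A, and A is a sum of maps of rank one whose
    images lie in ker psi. *)
Lemma hyperplane_disassemblable (psi : {scalar V}) (A : {linear V -> V}) e :
    psi e = 1 -> A e = 0 -> (forall x, psi (A x) = 0) ->
  completely_disassemblable (hyperplane_bracket psi A).
Proof.
move=> psi_e A_e psiA; pose n := \dim {:V}.
pose alpha (i : 'I_n) x := coord (vbasis {:V}) i (A x).
(* Projecting the basis to ker psi along e still expands A x, which lies
   in ker psi. *)
pose b (i : 'I_n) := (vbasis {:V})`_i - psi (vbasis {:V})`_i *: e.
have psi_b i : psi (b i) = 0 by rewrite linearB linearZ /= psi_e mulr1 subrr.
have alpha_lin i : scalar (alpha i).
  by move=> a x y; rewrite /alpha !linearP.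
pose alphaL i : {scalar V} :=
  HB.pack (alpha i) (GRing.isLinear.Build _ _ _ _ (alpha i) (alpha_lin i)).
pose B (r : seq 'I_n) x := \sum_(i <- r) alpha i x *: b i.
have B_lin r : linear (B r).
  move=> a x y; rewrite /B scaler_sumr -big_split /=; apply: eq_bigr => i _.
  by rewrite alpha_lin scalerDl scalerA.
pose BL r : {linear V -> V} :=
  HB.pack (B r) (GRing.isLinear.Build _ _ _ _ (B r) (B_lin r)).
have psiB r x : psi (B r x) = 0.
  by rewrite linear_sum big1 // => i _; rewrite linearZ /= psi_b mulr0.
have AB x : A x = \sum_i alpha i x *: b i.
  have -> : \sum_i alpha i x *: b i = A x - psi (A x) *: e; last first.
    by rewrite psiA scale0r subr0.
  rewrite [A x in RHS](coord_vbasis (memvf _)) linear_sum scaler_suml -sumrB.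
  by apply: eq_bigr => i _; rewrite [psi _]linearZ scalerBr scalerA.
suff dis_B r : completely_disassemblable (hyperplane_bracket psi (B r)).
  by apply: eq_disassemblable (dis_B _) => x y; rewrite /hyperplane_bracket !AB.
elim: r => [|i r IHr].
  by left=> x y; rewrite /hyperplane_bracket /B !big_nil !scaler0 subrr.
have Bcons x y : hyperplane_bracket psi (B (i :: r)) x y =
    (psi x * alpha i y - psi y * alpha i x) *: b i
      + hyperplane_bracket psi (B r) x y.
  rewrite /hyperplane_bracket /B !big_cons (scalerDr (psi x)).
  by rewrite (scalerDr (psi y)) !scalerA opprD addrACA -scalerBl.
apply: eq_disassemblable (fun x y => esym (Bcons x y)) _.
apply: add_disassemblable IHr.
  exact: eq_lie_bracket Bcons (@hyperplane_lie psi (BL (i :: r)) (psiB _)).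
apply: (@decomposable_disassemblable psi (alphaL i) e) => //=.
by rewrite /alpha A_e linear0.
Qed.

End HyperplaneBrackets.

(** * Descending along subalgebras of a solvable algebra *)

Section SolvableSubalgebras.
Variables (k : fieldType) (V : vectType k) (g : V -> V -> V).
Hypothesis g_lie : is_lie_bracket g.
Let g_bilin := lie_bilinear g_lie.

Lemma lie_derivedS (U W : {vspace V}) :
  (U <= W)%VS -> (lie_derived g U <= lie_derived g W)%VS.
Proof.
move=> /subvP sUW; apply/lie_derivedP=> // x y /sUW Wx /sUW Wy.
by apply: (lie_derivedP _ _ g_bilin).1 => //; apply: subvv.
Qed.

Lemma iter_lie_derivedS n (U W : {vspace V}) : (U <= W)%VS ->
  (iter n (lie_derived g) U <= iter n (lie_derived g) W)%VS.
Proof. by move=> sUW; elim: n => //= n; apply: lie_derivedS. Qed.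

Lemma lie_anticommute x y : g x y = - g y x.
Proof.
have := lie_alternating g_lie (x + y); case: g_bilin => gl gr.
have -> u v w : g (u + v) w = g u w + g v w.
  by have := gl w 1 u v; rewrite /= !scale1r.
have gDr u v w : g w (u + v) = g w u + g w v.
  by have := gr w 1 u v; rewrite /= !scale1r.
rewrite !gDr !(lie_alternating g_lie) add0r addr0.
by move/eqP; rewrite addr_eq0 => /eqP.
Qed.

(** As p fixes the subalgebra U, the restricted bracket is the direct sum of the
    subalgebra U and the abelian algebra ker p. *)
Lemma restriction_lie (U : {vspace V}) (p : {linear V -> V}) :
    (lie_derived g U <= U)%VS ->
    (forall x, p x \in U) -> (forall x, x \in U -> p x = x) ->
  is_lie_bracket (fun x y => g (p x) (p y)).
Proof.
move=> sDU pU p_id; have [gl gr] := g_bilin.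
have pg x y : p (g (p x) (p y)) = g (p x) (p y).
  by rewrite p_id //; apply: (lie_derivedP _ _ g_bilin).1 sDU _ _ _ _.
split=> [|x|x y z]; last by rewrite !pg (lie_jacobi g_lie).
  by split=> z a u v; rewrite linearP ?gl ?gr.
exact: lie_alternating.
Qed.

Lemma derived_proper n (U : {vspace V}) :
    iter n (lie_derived g) U = 0%VS -> U != 0%VS ->
  ~~ (U <= lie_derived g U)%VS.
Proof.
move=> Un0; apply: contraNN => sUD; rewrite -subv0 -Un0.
by elim: {Un0} n => //= n IHn; apply: subv_trans sUD (lie_derivedS IHn).
Qed.

(** Induction on the dimension of U. The projection p is arbitrary because the
    induction step modifies it: a hyperplane W of U is reached by the projection
    q with kernel ker p + <e>, not by a projection with kernel chosen in
    advance. *)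
Lemma solvable_subalgebra_disassemblable n (U : {vspace V})
    (p : {linear V -> V}) :
    (lie_derived g U <= U)%VS -> iter n (lie_derived g) U = 0%VS ->
    (forall x, p x \in U) -> (forall x, x \in U -> p x = x) ->
  completely_disassemblable (fun x y => g (p x) (p y)).
Proof.
have [d] := ubnP (\dim U); elim: d U p => // d IHd U p; rewrite ltnS => dimU.
move=> sDU Un0 pU p_id.
have [U0 | /derived_proper-/(_ n Un0)/subvPn[e eU eD]] := eqVneq U 0%VS.
  left=> x y; have := pU x; rewrite U0 memv0 => /eqP ->.
  by have := g_bilin.1 (p y) (-1) 0 0; rewrite /= !scaleN1r oppr0 addr0 addNr.
have [phi [phiD phi_e]] := separating_form eD.
(* The image of q is the hyperplane W of U on which phi vanishes. *)
pose q x := p x - phi (p x) *: e.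
have q_lin : linear q.
  move=> a x y; rewrite /q !linearP /= scalerDl -scalerA opprD addrACA.
  by rewrite scalerBr.
pose qL : {linear V -> V} :=
  HB.pack q (GRing.isLinear.Build _ _ _ _ q q_lin).
have qU x : q x \in U by rewrite rpredB ?rpredZ.
have phi_q x : phi (q x) = 0 by rewrite linearB linearZ /= phi_e mulr1 subrr.
have q_id x : x \in U -> phi x = 0 -> q x = x.
  by move=> xU phi_x; rewrite /q p_id // phi_x scale0r subr0.
have gU x y : x \in U -> y \in U -> g x y \in lie_derived g U.
  by apply: (lie_derivedP _ _ g_bilin).1 => //; apply: subvv.
pose W := limg (linfun qL).
have qW x : q x \in W by rewrite -[q x](lfunE qL) memv_img ?memvf.
have WP x : x \in W -> x \in U /\ phi x = 0.
  by case/memv_imgP=> y _ ->; rewrite lfunE.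
have sWU : (W <= U)%VS by apply/subvP=> x /WP[].
have sDW : (lie_derived g U <= W)%VS.
  by apply/subvP=> x xD; rewrite -(q_id x) ?phiD ?(subvP sDU).
have dimW : (\dim W < d)%N.
  apply: leq_trans dimU; rewrite ltn_neqAle dimvS // andbT.
  apply: contraTneq eU => dimWU; have /eqP <- : W == U.
    by rewrite eqEdim sWU dimWU leqnn.
  by apply/negP=> /WP[_ /eqP]; rewrite phi_e oner_eq0.
have dis_q : completely_disassemblable (fun x y => g (q x) (q y)).
  apply: (IHd W qL) => // [||x /WP[]]; last exact: q_id.
    exact: subv_trans (lie_derivedS sWU) sDW.
  by apply/eqP; rewrite -subv0 -Un0 iter_lie_derivedS.
have psi_lin : scalar (fun x => phi (p x)) by move=> a x y; rewrite !linearP.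
pose psi : {scalar V} :=
  HB.pack (fun x => phi (p x)) (GRing.isLinear.Build _ _ _ _ _ psi_lin).
have A_lin : linear (fun x => g e (q x)).
  by move=> a x y; rewrite q_lin g_bilin.2.
pose A : {linear V -> V} :=
  HB.pack (fun x => g e (q x)) (GRing.isLinear.Build _ _ _ _ _ A_lin).
(* Expand along p z = psi z *: e + q z; the terms in e and q z give the
   action of e. *)
have gE x y : g (p x) (p y) = g (q x) (q y) + hyperplane_bracket psi A x y.
  have pE z : p z = psi z *: e + q z by rewrite /q addrC subrK.
  have [gl gr] := g_bilin; rewrite [p x]pE [p y]pE gl !gr.
  rewrite (lie_alternating g_lie) /= scaler0 add0r [g (q x) e]lie_anticommute.
  by rewrite scalerN addrA addrC.
apply: eq_disassemblable (fun x y => esym (gE x y)) _.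
apply: add_disassemblable => //.
  exact: eq_lie_bracket gE (restriction_lie sDU pU p_id).
apply: (@hyperplane_disassemblable _ _ psi A e) => /= [||x].
- by rewrite p_id.
- have -> : q e = 0 by rewrite /q p_id // phi_e scale1r subrr.
  by have := g_bilin.2 e (-1) 0 0; rewrite /= !scaleN1r oppr0 addr0 addNr.
by rewrite p_id ?phiD ?(subvP sDU) ?gU.
Qed.

End SolvableSubalgebras.

Theorem proposition5p2 (k : fieldType) (k_char0 : [pchar k] =i pred0)
    (V : vectType k) (g : V -> V -> V) (g_lie : is_lie_bracket g)
    (g_solvable : lie_solvable g) :
  completely_disassemblable g.
Proof.
case: g_solvable => n gn0.
apply: (@solvable_subalgebra_disassemblable _ _ _ g_lie n fullv idfun) gn0 _ _.
- exact: subvf.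
- exact: memvf.
- by [].
Qed.
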